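(* The number of pairwise inequivalent sharp polynomials in $\mathcal{H}(2,2k)$ tends to infinity as $k\to\infty$; that is, for every positive integer $M$ there is $k_0$ such that for all integers $k\ge k_0$ there exist at least $M$ pairwise inequivalent sharp polynomials of degree $2k$ in $\mathcal{H}(2)$.
   Context: $\mathcal{H}(2)$ denotes the set of polynomials $p\in\mathbf{R}[x,y]$ all of whose coefficients are nonnegative and which satisfy $p(x,y)=1$ whenever $x+y=1$. $\mathcal{H}(2,d)$ is the set of elements of $\mathcal{H}(2)$ of degree $d$. A polynomial $p\in\mathcal{H}(2,d)$ is sharp if it has the fewest possible number of distinct monomials (with nonzero coefficient) among all elements of $\mathcal{H}(2,d)$. Elements $f,g\in\mathcal{H}(2,d)$ are equivalent if either $f=g$ or $f(x,y)=g(y,x)$, and inequivalent otherwise. *)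

(* Defs.v *)
From HB Require Import structures.
From mathcomp Require Import all_boot all_order all_algebra.
From mathcomp Require Import reals.
From mathcomp Require Import mpoly.

Set Implicit Arguments.
Unset Strict Implicit.
Unset Printing Implicit Defensive.

Import Order.TTheory GRing.Theory Num.Theory.

Local Open Scope ring_scope.

(* R[x, y] is {mpoly R[2]}, with x = 'X_0 and y = 'X_1 for 0, 1 : 'I_2; a point
   of the plane is a valuation v : 'I_2 -> R. *)

Definition inH (R : realType) (p : {mpoly R[2]}) : Prop :=
  (forall m : 'X_{1..2}, 0 <= p@_m) /\
  (forall v : 'I_2 -> R, v 0 + v 1 = 1 -> p.@[v] = 1).

(* msize p is the total degree plus one when p != 0, and 0 when p = 0. *)
Definition inHdeg (R : realType) (d : nat) (p : {mpoly R[2]}) : Prop :=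
  inH p /\ msize p = d.+1.

Definition nb_monomials (R : realType) (p : {mpoly R[2]}) : nat :=
  size (msupp p).

Definition sharp (R : realType) (d : nat) (p : {mpoly R[2]}) : Prop :=
  inHdeg d p /\
  (forall q : {mpoly R[2]},
     inHdeg d q -> (nb_monomials p <= nb_monomials q)%N).

(* The polynomial g(y, x). *)
Definition swap_vars (R : realType) (g : {mpoly R[2]}) : {mpoly R[2]} :=
  g \mPo [tuple 'X_1; 'X_0].

Definition equivalent (R : realType) (f g : {mpoly R[2]}) : Prop :=
  f = g \/ f = swap_vars g.

(* Main.v *)
Require Import Defs.
From HB Require Import structures.
From mathcomp Require Import all_boot all_order all_algebra.
From mathcomp Require Import reals.
From mathcomp Require Import mpoly.
From mathcomp Require Import zify ring lra.

Set Implicit Arguments.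
Unset Strict Implicit.
Unset Printing Implicit Defensive.

Import Order.TTheory GRing.Theory Num.Theory.

Local Open Scope ring_scope.

(** Lower bound: for [p] in H(2,d), let [P_j(t)] be the degree [j] part of [p]
    at [x = - t], [y = 1], and [U_0 = 1 - P_0],
    [U_(j+1) = (1 - t) U_j - P_(j+1)]. As [p = 1] on [x + y = 1], [U_d = 0];
    as the coefficients are nonnegative, [U_j(-1) > 0] for [j < d]. Count in a
    coefficient sequence the longest subsequence with alternating signs: it is
    at least [1] for [U_0], multiplication by [1 - t] increases it by at least
    [1], and subtracting a monomial decreases it by at most [2]. In the last
    step [P_d = (1 - t) U_(d-1)] has at least as many monomials as this count,
    which is at least [2]. Adding up, [d + 3 <= 2 N].

    Sharp polynomials: for odd [n] let [f_n] be [y^n] plus the [n]-th Lucas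
    polynomial in [x], [y]; it lies in H(2) and has [(n + 3) / 2] monomials.
    Replacing the term [y^n] of [f_n] by [y^n f_m], with [n + m = 2k], gives an
    element of H(2,2k) with [k + 2] monomials, hence a sharp one. Its pure
    powers are [x^n] and [y^(2k)], so different [n] give inequivalent ones. *)

(** * Sign alternations in coefficient sequences *)

(* The greedy length of a subsequence with alternating signs whose first term
   has the sign of [e]. *)
Fixpoint alternations (R : realDomainType) (e : R) (s : seq R) : nat :=
  if s is a :: s' then
    if 0 < e * a then (alternations (- e) s').+1 else alternations e s'
  else 0%N.

Lemma alternations_opp (R : realDomainType) (s : seq R) :
  forall e : R, (alternations e s <= (alternations (- e) s).+1)%N.
Proof.
elim: s => [//|a s IH] e /=.
case: ifP => h1; case: ifP => h2; move: (IH e) (IH (- e)); rewrite ?opprK; lia.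
Qed.

(** When [a] is counted, the scan of [s] waits for [- e] instead of [e], which shifts the rest by at
    most one. Hence altering one entry moves the count by at most two. *)
Lemma alternations_cons (R : realDomainType) (e a : R) (s : seq R) :
  (alternations e s <= alternations e (a :: s) <= (alternations e s).+2)%N.
Proof.
rewrite /=; case: ifP => _; last lia.
by move: (alternations_opp s e) (alternations_opp s (- e)); rewrite opprK; lia.
Qed.

Lemma alternations_gt0 (R : realDomainType) (a : R) (s : seq R) :
  a \in s -> a != 0 -> (0 < alternations a s)%N.
Proof.
move=> + a0; elim: s => [//|b s IH]; rewrite inE => /orP[/eqP <-|/IH] /=.
  by rewrite -expr2 exprn_even_gt0 //= a0.
by case: ifP.
Qed.

Lemma alternations_map_neq (R : realDomainType) (I : Type) (f g : I -> R)
    (r : seq I) :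
  forall e : R, (alternations e (map f r) <=
    alternations e (map g r) + 2 * count (fun i => f i != g i) r)%N.
Proof.
elim: r => [//|i r IH] e.
have := alternations_cons e (f i) (map f r).
have := alternations_cons e (g i) (map g r).
move: (IH e) (IH (- e)) => /=; case: (eqVneq (f i) (g i)) => [->|] /=;
  last by lia.
by case: ifP; lia.
Qed.

Lemma alternations_le_count (R : realDomainType) (s : seq R) :
  forall e : R, (alternations e s <= count (fun a : R => a != 0%R) s)%N.
Proof.
elim: s => [//|a s IH] e /=; case: ifP => h; last by move: (IH e); lia.
have -> : a != 0 by apply: contraTneq h => ->; rewrite mulr0 ltxx.
by move: (IH (- e)); lia.
Qed.

(* The coefficients of [(1 - 'X) * Poly s - b%:P]. *)
Fixpoint differences (R : zmodType) (b : R) (s : seq R) : seq R :=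
  if s is a :: s' then (a - b) :: differences a s' else [:: - b].

(** A relative of Descartes' rule of signs. The entry [b] before [s] does not have the awaited sign
    [e], so an entry of sign [e] forces a difference of that sign no later. After the last counted
    entry the differences telescope to its negative, so one of them gives the extra alternation. *)
Lemma alternations_differences (R : realDomainType) (s : seq R) :
  forall e b : R, e * b <= 0 ->
  (alternations e s + ((e * b < 0)%R || (0 < alternations e s)) <=
    alternations e (differences b s))%N.
Proof.
elim: s => [|a s IH] e b eb /=; first by rewrite mulrN oppr_gt0 orbF; case: ifP.
case: ifP => ea.
  have -> : 0 < e * (a - b) by lra.
  have := IH (- e) a; rewrite mulNr oppr_lt0 ea /= orbT addn1.
  by rewrite oppr_le0 ltW // => /(_ isT); lia.
have {}ea : e * a <= 0 by rewrite leNgt ea.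
have {}IH := IH e a ea.
case: ifP => eab.
  by move: (alternations_opp (differences a s) e); move: IH; lia.
apply: leq_trans IH; rewrite leq_add2l.
have : e * b < 0 -> e * a < 0 by move=> h; lra.
by case: (e * b < 0) => [->|_] //; case: (e * a < 0); case: (0 < _)%N.
Qed.

Lemma size_differences (R : zmodType) (s : seq R) (b : R) :
  size (differences b s) = (size s).+1.
Proof. by elim: s b => //= a s IH b; rewrite IH. Qed.

(** The default value [0] beyond [s] produces the final entry, minus the last element of
    [b :: s]. *)
Lemma nth_differences (R : zmodType) (s : seq R) (b : R) (i : nat) :
  (differences b s)`_i = s`_i - (b :: s)`_i.
Proof.
elim: s b i => [|a s IH] b [|i] //=; rewrite ?sub0r //.
by rewrite !nth_nil ?sub0r ?subr0 ?oppr0.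
Qed.

Lemma differences_mkseq_coef (R : nzRingType) (p : {poly R}) (n : nat) :
  (size p <= n)%N ->
  differences 0 (mkseq (fun i => p`_i) n) =
    mkseq (fun i => ((1 - 'X) * p)`_i) n.+1.
Proof.
move=> pn; set s := mkseq _ _.
have coef_s j : s`_j = p`_j.
  have [jn|nj] := ltnP j n; first exact: nth_mkseq.
  by rewrite !nth_default ?size_mkseq // (leq_trans pn).
apply: (@eq_from_nth _ 0) => [|i].
  by rewrite size_differences !size_mkseq.
rewrite size_differences size_mkseq => lt_i.
rewrite nth_differences [RHS]nth_mkseq // coef_s mulrBl mul1r coefB coefXM.
by case: i lt_i => //= i _; rewrite coef_s.
Qed.

(** * Lower bound for the number of monomials *)

Section LowerBound.

Variables (R : realType) (d : nat) (p : {mpoly R[2]}).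
Hypothesis pd : inHdeg d p.

Local Notation m0 m := ((m : 'X_{1..2}) 0).

Definition count_mdeg (P : pred nat) : nat :=
  count (fun m : 'X_{1..2} => P (mdeg m)) (msupp p).

(* With [t] for ['X], the part of degree [j] of [p] at [x = - t], [y = 1]. *)
Definition signed_row (j : nat) : {poly R} :=
  \sum_(m <- msupp p | mdeg m == j) (p@_m * (-1) ^+ m0 m) *: 'X^(m0 m).

(** This is [1] minus the parts of degree at most [j], homogenized to degree [j] by powers of
    [x + y] and taken at [x = - t], [y = 1], where [x + y = 1 - t]. *)
Definition remainder (j : nat) : {poly R} :=
  (1 - 'X) ^+ j - \sum_(i < j.+1) (1 - 'X) ^+ (j - i) * signed_row i.

Lemma remainder0 : remainder 0 = 1 - signed_row 0.
Proof. by rewrite /remainder big_ord1 !expr0 mul1r. Qed.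

Lemma remainderS j : remainder j.+1 = (1 - 'X) * remainder j - signed_row j.+1.
Proof.
rewrite /remainder [in LHS]big_ord_recr /= subnn expr0 mul1r opprD addrA.
congr (_ - _); rewrite mulrBr -exprS mulr_sumr; congr (_ - _).
by apply: eq_bigr => i _; rewrite mulrA -exprS subSn // -ltnS.
Qed.

Lemma size_signed_row j : (size (signed_row j) <= j.+1)%N.
Proof.
apply: (leq_trans (size_sum _ _ _)); apply/bigmax_leqP_seq => m _ /eqP <-.
apply: (leq_trans (size_scale_leq _ _)); rewrite size_polyXn ltnS mdegE.
by rewrite big_ord_recl leq_addr.
Qed.

Lemma size_remainder j : (size (remainder j) <= j.+1)%N.
Proof.
elim: j => [|j IH].
  rewrite remainder0 (leq_trans (size_polyD _ _)) // size_polyN geq_max.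
  by rewrite size_poly1 size_signed_row.
rewrite remainderS (leq_trans (size_polyD _ _)) // size_polyN geq_max.
rewrite size_signed_row andbT (leq_trans (size_polyMleq _ _)) //.
have -> : size (1 - 'X : {poly R}) = 2 by rewrite -opprB size_polyN size_XsubC.
by rewrite /= ltnS.
Qed.

Lemma count_signed_row j n :
  (count (fun i => (signed_row j)`_i != 0)%R (iota 0 n) <=
    count_mdeg (pred1 j))%N.
Proof.
rewrite /count_mdeg -2!size_filter.
rewrite -[leqRHS](size_map (fun m : 'X_{1..2} => m 0)).
apply: uniq_leq_size => [|i]; first by rewrite filter_uniq ?iota_uniq.
rewrite mem_filter => /andP[+ _]; apply: contraR => i_notin.
rewrite /signed_row coef_sum big_seq_cond big1 // => m /andP[m_in mj].
rewrite coefZ coefXn; case: eqVneq => [im|_]; last by rewrite mulr0.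
by case/mapP: i_notin; exists m; rewrite // mem_filter /= mj.
Qed.

Lemma sum_coef_half : \sum_(m <- msupp p) p@_m * 2^-1 ^+ mdeg m = 1.
Proof.
have [[_ p1] _] := pd; rewrite -[RHS](p1 (fun=> 2^-1)) ?mevalE; last by field.
apply: eq_bigr => m _; congr (_ * _).
by rewrite mdegE !big_ord_recl !big_ord0 addn0 mulr1 exprD.
Qed.

Lemma horner_signed_row (j : nat) (x : R) :
  (signed_row j).[x] = \sum_(m <- msupp p | mdeg m == j) p@_m * (- x) ^+ m0 m.
Proof.
rewrite horner_sum; apply: eq_bigr => m _.
by rewrite hornerZ hornerXn -mulrA -exprMn mulN1r.
Qed.

(** The point [(- x, 1)] is [1 - x] times the point [(- x / (1 - x), 1 / (1 - x))] of the line
    [x + y = 1], and the homogenized remainder scales accordingly. *)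
Lemma horner_remainder (j : nat) (x : R) : x != 1 ->
  (remainder j).[x] = (1 - x) ^+ j *
    (1 - \sum_(m <- msupp p | (mdeg m <= j)%N)
           p@_m * ((- x) ^+ m0 m / (1 - x) ^+ mdeg m)).
Proof.
move=> x1; have x1u : 1 - x != 0 by rewrite subr_eq0 eq_sym.
rewrite /remainder !hornerE mulrBr mulr1; congr (_ - _).
rewrite horner_sum (partition_big
  (fun m : 'X_{1..2} => inord (mdeg m) : 'I_j.+1) predT) //= mulr_sumr.
apply: eq_bigr => i _.
rewrite !hornerE horner_signed_row !mulr_sumr; apply: eq_big => m.
  apply/eqP/andP => [->|[mj /eqP <-]]; last by rewrite inordK.
  by rewrite -ltnS ltn_ord inord_val eqxx.
move=> /eqP ->; have ij : (i <= j)%N by rewrite -ltnS.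
have -> : (1 - x) ^+ j = (1 - x) ^+ (j - i) * (1 - x) ^+ i.
  by rewrite -exprD subnK.
by field; rewrite expf_neq0.
Qed.

Lemma mdeg_le m : m \in msupp p -> (mdeg m <= d)%N.
Proof. by move=> /msize_mdeg_lt; have [_ ->] := pd. Qed.

Lemma exists_mdeg : exists2 m, m \in msupp p & mdeg m = d.
Proof.
have [_ p_size] := pd.
have p0 : p != 0 by rewrite -msize_poly_eq0 p_size.
exists (mlead p); first exact: mlead_supp.
by apply: succn_inj; rewrite mlead_deg.
Qed.

Lemma remainder_neq0 j : (j < d)%N -> remainder j != 0.
Proof.
move=> jd; suff: 0 < (remainder j).[-1].
  by apply: contraTneq => ->; rewrite horner0 ltxx.
have [[p_ge0 _] _] := pd.
rewrite horner_remainder; last by rewrite lt_eqF //; lra.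
rewrite mulr_gt0 ?exprn_gt0 ?subr_gt0 //; first lra.
have [m m_in md] := exists_mdeg.
have jm : ~~ (mdeg m <= j)%N by rewrite md -ltnNge.
(* For [x = -1] the point of the line is [(1/2, 1/2)]. Writing [1] as the value of [p] there leaves
   the monomials of degree above [j], among which [m] contributes a positive term. *)
rewrite -[ltRHS]sum_coef_half [ltRHS](bigID (fun m => mdeg m <= j)%N) /=.
rewrite [X in _ < X + _](eq_bigr (fun m : 'X_{1..2} =>
  p@_m * ((- -1) ^+ m0 m / (1 - -1) ^+ mdeg m))); last first.
  by move=> m' _; rewrite opprK expr1n mul1r exprVn.
rewrite ltrDl lt_neqAle sumr_ge0 ?andbT => [|m' _]; last first.
  by rewrite mulr_ge0 ?exprn_ge0 ?invr_ge0.
rewrite eq_sym psumr_neq0 => [|m' _]; last first.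
  by rewrite mulr_ge0 ?exprn_ge0 ?invr_ge0.
apply/hasP; exists m => //; rewrite jm /= mulr_gt0 ?exprn_gt0 ?invr_gt0 //.
by rewrite lt_neqAle p_ge0 eq_sym -mcoeff_msupp m_in.
Qed.

Lemma remainder_eq0 : remainder d = 0.
Proof.
(* The size bound makes [d + 1] roots enough; starting at [2] avoids [1], where the rescaling breaks
   down. *)
pose rs : seq R := [seq i.+2%:R | i <- iota 0 d.+1].
apply: (@roots_geq_poly_eq0 _ _ rs).
- apply/allP => _ /mapP[i _ ->]; set x : R := i.+2%:R.
  have x1 : x != 1 by rewrite /x -(@natr1 _ i.+1) -subr_eq0 addrK pnatr_eq0.
  have x1u : 1 - x != 0 by rewrite subr_eq0 eq_sym.
  rewrite /root horner_remainder //.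
  pose v (i : 'I_2) := if i == 0 then - x / (1 - x) else (1 - x)^-1.
  have [[_ p1] _] := pd; rewrite mulf_eq0 subr_eq0.
  rewrite -[X in _ || (X == _)](p1 v); last first.
    by rewrite /v /= -[X in _ + X]mul1r -mulrDl addrC divff.
  apply/orP; right; rewrite mevalE big_seq [X in _ == X]big_seq_cond.
  rewrite [X in _ == X](eq_bigl (fun m => m \in msupp p)); last first.
    by move=> m; rewrite /= andb_idr // => /mdeg_le.
  apply/eqP/eq_bigr => m _; congr (_ * _).
  rewrite !big_ord_recl big_ord0 mulr1 /v /= mdegE !big_ord_recl big_ord0.
  by rewrite addn0 exprMn exprD !exprVn invfM mulrA.
- rewrite map_inj_uniq ?iota_uniq // => i j /eqP.
  by rewrite eqr_nat => /eqP [].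
- by rewrite size_map size_iota size_remainder.
Qed.

Local Notation coefs n q := (mkseq (fun i => (q : {poly R})`_i) n).

Lemma alternations_remainderS (j : nat) (e : R) :
  (alternations e (differences 0 (coefs j.+1 (remainder j))) <=
   alternations e (coefs j.+2 (remainder j.+1)) +
     2 * count_mdeg (pred1 j.+1))%N.
Proof.
rewrite differences_mkseq_coef ?size_remainder //.
apply: leq_trans
  (alternations_map_neq _ (fun i => (remainder j.+1)`_i) _ _) _.
rewrite leq_add2l leq_mul2l /=.
apply: leq_trans (count_signed_row _ j.+2); apply: sub_count => i /=.
by apply: contraNneq => row0; rewrite remainderS coefB row0 subr0.
Qed.

Lemma alternations_coefs_gt0 (q : {poly R}) (n : nat) :
  q != 0 -> (size q <= n)%N -> exists e, (0 < alternations e (coefs n q))%N.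
Proof.
move=> q0 qn; exists (lead_coef q); apply: alternations_gt0; last first.
  by rewrite lead_coef_eq0.
apply/mapP; exists (size q).-1 => //; rewrite mem_iota /=.
by rewrite (leq_trans _ qn) // prednK // lt0n size_poly_eq0.
Qed.

Lemma alternations_remainder (j : nat) : (j < d)%N ->
  exists2 e, (0 < alternations e (coefs j.+1 (remainder j)))%N &
    (j < alternations e (coefs j.+1 (remainder j)) +
       2 * count_mdeg (leq^~ j))%N.
Proof.
elim: j => [|j IH] jd.
  have [e e0] := alternations_coefs_gt0 (remainder_neq0 jd) (size_remainder 0).
  by exists e; rewrite // ltn_addr.
have [e e0 ej] := IH (ltnW jd).
have := @alternations_differences _ (coefs j.+1 (remainder j)) e 0.
rewrite mulr0 lexx e0 orbT => /(_ isT) e_diff.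
have eS := leq_trans e_diff (alternations_remainderS j e).
have countS : (count_mdeg (leq^~ j.+1) =
    count_mdeg (leq^~ j) + count_mdeg (pred1 j.+1))%N.
  rewrite /count_mdeg -count_predUI.
  rewrite [X in (_ + X)%N](eq_count (a2 := pred0)) ?count_pred0 ?addn0.
    by apply: eq_count => m /=; rewrite leq_eqVlt ltnS orbC.
  by move=> m /=; case: eqP => [->|_]; rewrite ?ltnn ?andbF.
(* If the count from [e] drops to [0], the monomials of degree [j + 1] alone pay for the step. The
   remainder is still nonzero, so another starting sign [e'] restores positivity. *)
have [e1|e1] := posnP (alternations e (coefs j.+2 (remainder j.+1)));
  last first.
  by exists e => //; lia.
have [e' e'0] :=
  alternations_coefs_gt0 (remainder_neq0 jd) (size_remainder j.+1).
by exists e' => //; lia.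
Qed.

Lemma degree_bound : (0 < d)%N -> (d + 3 <= 2 * nb_monomials p)%N.
Proof.
move=> d_gt0; have dS : d = d.-1.+1 by rewrite prednK.
have [|e e0 ed] := @alternations_remainder d.-1; first by rewrite prednK.
have := @alternations_differences _ (coefs d.-1.+1 (remainder d.-1)) e 0.
rewrite mulr0 lexx e0 orbT => /(_ isT) e_diff.
have signed_row_d : (1 - 'X) * remainder d.-1 = signed_row d.
  by apply/eqP; rewrite -subr_eq0 {2}dS -remainderS -dS remainder_eq0.
rewrite differences_mkseq_coef ?size_remainder // signed_row_d in e_diff.
have := alternations_le_count (coefs d.-1.+2 (signed_row d)) e.
rewrite count_map => /leq_trans/(_ (count_signed_row d d.-1.+2)) e_count.
have -> : nb_monomials p = (count_mdeg (leq^~ d.-1) + count_mdeg (pred1 d))%N.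
  rewrite /count_mdeg -count_predUI.
  rewrite [X in (_ + X)%N](eq_count (a2 := pred0)); last first.
    move=> m /=; case: eqP => [->|]; rewrite ?andbF //.
    by rewrite [in (d <= _)%N]dS ltnn.
  rewrite count_pred0 addn0 /nb_monomials -[LHS]count_predT.
  apply: eq_in_count => m /mdeg_le /=; rewrite leq_eqVlt [in (_ < d)%N]dS ltnS.
  by rewrite orbC => ->.
(* With [a >= 1] alternations before the last step and [c] monomials of degree below [d], one has
   [d <= a + 2 c] and at least [a + 1] monomials of degree [d]. So
   [2 N >= 2 c + 2 a + 2 >= d + 3]. *)
by move: (leq_trans e_diff e_count); lia.
Qed.

End LowerBound.

(** * Lucas polynomials in two variables *)

Section LucasPolynomials.

Variable R : realType.

(* [a ^+ n + b ^+ n], where [a] and [b] are the roots of [T^2 - x T - y]; these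
   roots are [1] and [- y] on the line [x + y = 1]. *)
Fixpoint lucas (n : nat) : {mpoly R[2]} :=
  match n with
  | 0 => 2%:R
  | n'.+1 => if n' is n''.+1 then 'X_0 * lucas n' + 'X_1 * lucas n'' else 'X_0
  end.

Arguments lucas : simpl never.

Lemma lucasSS n : lucas n.+2 = 'X_0 * lucas n.+1 + 'X_1 * lucas n.
Proof. by []. Qed.

Lemma lucas_ind (P : nat -> {mpoly R[2]} -> Prop) :
  P 0%N 2%:R -> P 1%N 'X_0 ->
  (forall n p q, P n p -> P n.+1 q -> P n.+2 ('X_0 * q + 'X_1 * p)) ->
  forall n, P n (lucas n).
Proof.
move=> P0 P1 PS n; suff: P n (lucas n) /\ P n.+1 (lucas n.+1) by case.
by elim: n => [|n [IHn IHSn]]; split=> //; rewrite lucasSS; apply: PS.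
Qed.

Definition nonneg_coef (p : {mpoly R[2]}) : Prop := forall m, 0 <= p@_m.

Lemma nonneg_coefD p q : nonneg_coef p -> nonneg_coef q -> nonneg_coef (p + q).
Proof. by move=> p0 q0 m; rewrite mcoeffD addr_ge0. Qed.

Lemma nonneg_coefM p q : nonneg_coef p -> nonneg_coef q -> nonneg_coef (p * q).
Proof.
by move=> p0 q0 m; rewrite mcoeffM sumr_ge0 // => k _; rewrite mulr_ge0.
Qed.

Lemma nonneg_coefXn i n : nonneg_coef ('X_i ^+ n).
Proof. by move=> m; rewrite mcoeffXn ler0n. Qed.

Lemma nonneg_coef_lucas n : nonneg_coef (lucas n).
Proof.
apply: (lucas_ind (P := fun=> nonneg_coef)) => [m||k p q p0 q0].
- by rewrite mcoeffMn mcoeff1 mulrn_wge0 ?ler0n.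
- exact: (nonneg_coefXn 0 1).
- by apply: nonneg_coefD; apply: nonneg_coefM => //; apply: (nonneg_coefXn _ 1).
Qed.

Lemma lucas_line (v : 'I_2 -> R) n :
  v 0 + v 1 = 1 -> (lucas n).@[v] = 1 + (- v 1) ^+ n.
Proof.
move=> v1; apply: (lucas_ind (P := fun n p => p.@[v] = 1 + (- v 1) ^+ n)).
- by rewrite mevalMn meval1 expr0.
- by rewrite mevalXU expr1 -v1; ring.
- move=> k p q pE qE; rewrite mevalD !mevalM !mevalXU pE qE !exprS.
  by rewrite (_ : v 0 = 1 - v 1); [ring | rewrite -v1; ring].
Qed.

(** The values on the axes isolate the pure powers, which later tell the sharp polynomials apart. *)
Lemma lucas_x_axis (v : 'I_2 -> R) n :
  v 1 = 0 -> (lucas n.+1).@[v] = v 0 ^+ n.+1.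
Proof.
move=> v1; elim: n => [|n IH]; first by rewrite mevalXU.
by rewrite lucasSS mevalD !mevalM !mevalXU v1 mul0r addr0 IH -exprS.
Qed.

Lemma lucas_odd_y_axis (v : 'I_2 -> R) n :
  v 0 = 0 -> (lucas n.*2.+1).@[v] = 0.
Proof.
move=> v0; elim: n => [|n IH]; first by rewrite mevalXU.
by rewrite doubleS lucasSS mevalD !mevalM !mevalXU v0 mul0r IH mulr0 addr0.
Qed.

Lemma msuppXM i (p : {mpoly R[2]}) m :
  m \in msupp ('X_i * p) -> exists2 m', m' \in msupp p & m = (U_(i) + m')%MM.
Proof.
rewrite mulrC (perm_mem (msuppMX _ _)) => /mapP[m' m'_in ->].
by exists m'; rewrite // addmC.
Qed.

(** The recursion is homogeneous for weights [1] of [x] and [2] of [y]. So the exponent of [y]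
    determines the monomial and is at most [n./2]. *)
Lemma msupp_lucas n m : m \in msupp (lucas n) -> (m 0%R + 2 * m 1%R = n)%N.
Proof.
move: m; apply: (lucas_ind (P := fun n p =>
  forall m, m \in msupp p -> (m 0%R + 2 * m 1%R = n)%N)) => [m|m|k p q pS qS m].
- rewrite mcoeff_msupp mcoeffMn mcoeff1.
  by case: (eqVneq m 0%MM) => [->|_]; rewrite ?mul0rn ?eqxx ?mnm0E.
- by rewrite msuppX inE => /eqP ->; rewrite !mnm1E.
- move/msuppD_le; rewrite mem_cat => /orP[] /msuppXM[m' m'_in ->];
    rewrite !mnmDE !mnm1E /=; [move: (qS _ m'_in)|move: (pS _ m'_in)]; lia.
Qed.

Lemma size_msupp_lucas n : (size (msupp (lucas n)) <= n./2.+1)%N.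
Proof.
rewrite -(size_map (fun m : 'X_{1..2} => m 1)) -(size_iota 0 n./2.+1).
apply: uniq_leq_size => [|_ /mapP[m /msupp_lucas m_in ->]].
  rewrite map_inj_in_uniq ?msupp_uniq // => m m' /msupp_lucas m_in.
  move=> /msupp_lucas m'_in mm'; apply/mnmP => i.
  have [->|->] : i = 0 \/ i = 1; last by [].
    by case: i => [[|[|i]] lt_i] //; [left|right]; apply: val_inj.
  lia.
by rewrite mem_iota /= add0n ltnS; lia.
Qed.

Lemma mdeg_lucas n m : m \in msupp (lucas n) -> (mdeg m <= n)%N.
Proof.
move=> /msupp_lucas <-; rewrite mdegE big_ord_recl big_ord1 leq_add2l.
have -> : lift ord0 ord0 = 1 :> 'I_2 by apply: val_inj.
by rewrite leq_pmull.
Qed.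

(** * Sharp polynomials of even degree *)

(* [lucas r.*2.+1 + 'X_1 ^+ r.*2.+1] and its analogue for [s] belong to [H(2)]:
   here the pure power of [y] of the first one is multiplied by the second. *)
Definition tensor_lucas (r s : nat) : {mpoly R[2]} :=
  lucas r.*2.+1 + (lucas s.*2.+1 + 'X_1 ^+ s.*2.+1) * 'X_1 ^+ r.*2.+1.

Lemma tensor_lucas_inH r s : inH (tensor_lucas r s).
Proof.
split=> [|v v1].
  apply: nonneg_coefD; first exact: nonneg_coef_lucas.
  apply: nonneg_coefM; last exact: nonneg_coefXn.
  by apply: nonneg_coefD; [exact: nonneg_coef_lucas|exact: nonneg_coefXn].
rewrite mevalD mevalM mevalD !lucas_line // !rmorphXn /= mevalXU.
(* For odd [n] the Lucas polynomial is [1 - y^n] on the line, so the bracketed factor is [1] and the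
   sum is [(1 - y^n) + y^n]. *)
have odd_sign n : (- v 1) ^+ n.*2.+1 = - v 1 ^+ n.*2.+1.
  by rewrite exprNn -signr_odd /= odd_double expr1 mulN1r.
by rewrite !odd_sign; ring.
Qed.

Lemma msize_tensor_lucas r s :
  msize (tensor_lucas r s) = (2 * (r + s).+1).+1.
Proof.
apply/eqP; rewrite eqn_leq; apply/andP; split.
  rewrite msizeE; apply/bigmax_leqP_seq => m + _.
  move=> /msuppD_le; rewrite mem_cat => /orP[/mdeg_lucas|]; first lia.
  rewrite (mpolyXn _ _ r.*2.+1) (perm_mem (msuppMX _ _)) => /mapP[m' + ->].
  rewrite mdegD mdegMn mdeg1.
  move=> /msuppD_le; rewrite mem_cat => /orP[/mdeg_lucas|]; first lia.
  by rewrite mpolyXn msuppX inE => /eqP ->; rewrite mdegMn mdeg1; lia.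
(* The top pure power of [y] survives, since nonnegative coefficients cannot cancel it. *)
pose m := (U_(1) *+ (2 * (r + s).+1) : 'X_{1..2})%MM.
have -> : (2 * (r + s).+1 = mdeg m)%N by rewrite mdegMn mdeg1 mul1n.
apply: msize_mdeg_lt; rewrite mcoeff_msupp gt_eqF //.
rewrite /tensor_lucas mulrDl -exprD addrA mcoeffD mcoeffXn.
have -> : (s.*2.+1 + r.*2.+1 = 2 * (r + s).+1)%N by lia.
rewrite eqxx ltr_wpDl //; apply: nonneg_coefD; first exact: nonneg_coef_lucas.
by apply: nonneg_coefM; [exact: nonneg_coef_lucas|exact: nonneg_coefXn].
Qed.

Lemma nb_monomials_tensor_lucas r s :
  (nb_monomials (tensor_lucas r s) <= r + s + 3)%N.
Proof.
have sizeD (p q : {mpoly R[2]}) :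
    (size (msupp (p + q)) <= size (msupp p) + size (msupp q))%N.
  by rewrite -size_cat uniq_leq_size ?msupp_uniq //; apply: msuppD_le.
apply: leq_trans (sizeD _ _) _.
rewrite (mpolyXn _ _ r.*2.+1) (perm_size (msuppMX _ _)).
rewrite (size_map (fun m => (U_(1) *+ r.*2.+1 + m)%MM)).
have := sizeD (lucas s.*2.+1) ('X_1 ^+ s.*2.+1).
have -> : size (msupp ('X_1 ^+ s.*2.+1 : {mpoly R[2]})) = 1%N.
  by rewrite mpolyXn msuppX.
have := size_msupp_lucas r.*2.+1; have := size_msupp_lucas s.*2.+1.
by rewrite -!uphalfE !uphalf_double; lia.
Qed.

Lemma tensor_lucas_x_axis (v : 'I_2 -> R) r s :
  v 1 = 0 -> (tensor_lucas r s).@[v] = v 0 ^+ r.*2.+1.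
Proof.
move=> v1; rewrite mevalD mevalM lucas_x_axis // !rmorphXn /= mevalXU v1.
by rewrite expr0n mulr0 addr0.
Qed.

Lemma tensor_lucas_y_axis (v : 'I_2 -> R) r s :
  v 0 = 0 -> (tensor_lucas r s).@[v] = v 1 ^+ (2 * (r + s).+1).
Proof.
move=> v0; rewrite mevalD mevalM mevalD !lucas_odd_y_axis // !rmorphXn /=.
by rewrite mevalXU !add0r -exprD; congr (_ ^+ _); lia.
Qed.

Lemma tensor_lucas_sharp r s : sharp (2 * (r + s).+1) (tensor_lucas r s).
Proof.
split=> [|q qd]; first by split;
  [exact: tensor_lucas_inH|exact: msize_tensor_lucas].
(* The bound reads [2 (r + s) + 5 <= 2 N]; its left side is odd, so [r + s + 3 <= N]. *)
have := degree_bound qd isT; have := nb_monomials_tensor_lucas r s; lia.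
Qed.

Lemma tensor_lucas_equivalent r s r' s' : (r + s = r' + s')%N ->
  equivalent (tensor_lucas r s) (tensor_lucas r' s') -> r = r'.
Proof.
move=> rs; pose v (i : 'I_2) : R := if i == 0 then 2%:R else 0.
have exp2_inj (a b : nat) : 2%:R ^+ a = 2%:R ^+ b :> R -> a = b.
  move=> /eqP; rewrite -!natrX eqr_nat eqn_exp2l // => /eqP //.
case=> /(congr1 (meval v)); rewrite tensor_lucas_x_axis //.
  by rewrite tensor_lucas_x_axis // => /exp2_inj; lia.
(* After the swap the point [(2, 0)] becomes [(0, 2)], and an odd exponent would equal an even
   one. *)
rewrite comp_mpoly_meval tensor_lucas_y_axis /=; last by rewrite mevalXU.
by rewrite mevalXU => /exp2_inj; lia.
Qed.

End LucasPolynomials.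

Theorem mainTheorem5 (R : realType) :
  forall M : nat, (0 < M)%N ->
  exists k0 : nat, forall k : nat, (k0 <= k)%N ->
  exists F : 'I_M -> {mpoly R[2]},
    (forall i : 'I_M, sharp (2 * k)%N (F i)) /\
    (forall i j : 'I_M, i <> j -> ~ equivalent (F i) (F j)).
Proof.
(* For [i < M <= k] the subtraction does not truncate, so the degree is [2 k]. *)
move=> M _; exists M => k Mk; exists (fun i => tensor_lucas R i (k.-1 - i)).
have sum_k (i : 'I_M) : ((i + (k.-1 - i)).+1 = k)%N.
  by have := ltn_ord i; lia.
split=> [i|i j ij]; first by have := tensor_lucas_sharp R i (k.-1 - i);
  rewrite sum_k.
move=> /tensor_lucas_equivalent ij_eq; apply: ij; apply: val_inj.
by apply: ij_eq; apply: succn_inj; rewrite !sum_k.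
Qed.
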